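(* Let $G$ be a connected ribbon graph with $n$ edges (also called chords) numbered $1,\dots,n$, and let $L(G)\subset V=\mathbb{F}_2^{2n}=\langle e_1,\dots,e_n,f_1,\dots,f_n\rangle$ be its $L$-space. Then: (1) For any chord $i$, $L(\mu_i(G))=M_i(L(G))$, where $M_i:V\to V$ is the linear map interchanging $e_i$ and $f_i$ and fixing all other elements of the standard basis of $V$. (2) For any two distinct chords $i,j$ with neighboring half-edges, $L(v_1^{ij}(G))=T_1^{ij}(L(G))$, where $T_1^{ij}:V\to V$ is the linear map with $$T_1^{ij}(f_i)=f_i+e_j,\quad T_1^{ij}(f_j)=f_j+e_i,\quad T_1^{ij}(e_i)=e_i,\quad T_1^{ij}(e_j)=e_j,$$ fixing all other standard basis elements of $V$. (3) For any two distinct chords $i,j$ with neighboring half-edges ($i$ the fixed chord and $j$ the moving chord), $L(v_2^{ij}(G))=T_2^{ij}(L(G))$, where $T_2^{ij}:V\to V$ is the linear map with $$T_2^{ij}(e_i)=e_i+e_j,\quad T_2^{ij}(f_j)=f_j+f_i,\quad T_2^{ij}(f_i)=f_i,\quad T_2^{ij}(e_j)=e_j,$$ fixing all other standard basis elements of $V$.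
   Context: A ribbon graph $G$ is a compact surface with boundary (possibly non-orientable) represented as the union of two finite sets of closed topological disks, the vertices (pairwise disjoint) and the edges, also called ribbons or chords (pairwise disjoint), such that edges and vertices intersect along disjoint line segments contained in their boundaries, each such segment lies in precisely one edge and one vertex, and each edge contains exactly two such segments. So each edge is a rectangle glued to vertex boundaries along two opposite sides (the attaching sides); its two other sides are the free sides. Ribbon graphs are considered up to homeomorphisms preserving the decomposition into vertices and edges (and here the numbering of the edges). $L$-space. $V=\mathbb{F}_2^{2n}$ has basis $e_1,\dots,e_n,f_1,\dots,f_n$ and alternating form determined by $(e_i,f_j)=\delta_{ij}$, $(e_i,e_j)=(f_i,f_j)=0$. The punctured ribbon graph $\widehat{G}$ is obtained from $G$ by removing an open disk from the interior of each vertex. For each edge $E_i$, let $\alpha_i$ be an arc inside $E_i$ connecting the two free sides of $E_i$, and let $\beta_i$ be the arc going lengthwise along $E_i$, leaving $E_i$ through its two attaching sides and continuing inside the adjacent vertices straight to the boundaries of the punctures in these vertices. They define classes $[\alpha_i],[\beta_i]\in H_1(\widehat{G},\partial\widehat{G};\mathbb{F}_2)$. With the intersection pairing $\cap$ between $H_1(\widehat{G};\mathbb{F}_2)$ and $H_1(\widehat{G},\partial\widehat{G};\mathbb{F}_2)$, put $\varphi_G(\gamma)=\sum_i(\gamma\cap[\alpha_i])e_i+\sum_i(\gamma\cap[\beta_i])f_i\in V$ for $\gamma\in H_1(\widehat G;\mathbb{F}_2)$. The $L$-space is $L(G):=\operatorname{Im}\varphi_G$. Partial dual (Morse perestroika)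 $\mu_i(G)$. Let $S$ be the union of the boundary circles of the vertices of $G$. Replace $S$ by $S'=S\,\triangle\,\partial(i)$: remove from $S$ the two attaching sides of the ribbon $i$ and add its two free sides. $S'$ is again a union of circles; attach a disk to each of them (these are the vertices of $\mu_i(G)$) and glue back the same ribbons as in $G$ (the ribbon $i$ is now attached along its former free sides, the other ribbons along the same segments as before). Vassiliev moves. Let $i\neq j$ be edges having half-edges attached to the same vertex $v$ which are neighboring, i.e. some arc of $\partial v$ joins a corner $p$ of the attaching side of the half-edge of $i$ to a corner of the attaching side of the half-edge of $j$ and meets no other attaching segment. (The moves depend on this choice, which is suppressed in the notation.) The first Vassiliev move $v_1^{ij}(G)$ is obtained by attaching these two half-edges to $v$ along the same two segments, but in the other order (without twisting). The second Vassiliev move $v_2^{ij}(G)$ ($i$ fixed, $j$ moving) is obtained by sliding this end of $j$ along the free side of the ribbon $i$ starting at the corner $p$, until it reaches the vertex at the other end of $i$, where it is attached to the vertex boundary immediately next to the other corner of that free side.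
   Formalization: In the formal version φ_G takes crossings with β_i as the e_i-coordinate and crossings with α_i as the f_i-coordinate (e and f interchanged); with the formula as printed, part (2) fails for one vertex with two untwisted non-interlaced loops. *)

(* Defs.v *)
From HB Require Import structures.
From mathcomp Require Import all_boot all_order all_algebra.
From mathcomp Require Import perm ring_quotient.

Set Implicit Arguments.
Unset Strict Implicit.
Unset Printing Implicit Defensive.

Import GRing.Theory.
Local Open Scope ring_scope.
Local Open Scope quotient_scope.

Section QuotientSpace.

Import VectorInternalTheory.

Variables (K : fieldType) (V : vectType K) (W : {vspace V}).

Definition quotv := Quotient.quot (pred_of_vspace W).

HB.instance Definition _ := GRing.Zmodule.on quotv.

Definition quotv_pi (x : V) : quotv := \pi_(Quotient.quot (pred_of_vspace W)) x.

Lemma quotv_piK (x : quotv) : quotv_pi (repr x) = x.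
Proof. exact: reprK. Qed.

Lemma quotv_piE (x y : V) : (quotv_pi x == quotv_pi y) = (x - y \in W).
Proof. by rewrite Quotient.idealrBE. Qed.

Lemma quotv_eq (x y : V) : x - y \in W -> quotv_pi x = quotv_pi y.
Proof. by move=> h; apply/eqP; rewrite quotv_piE. Qed.

Lemma quotv_repr (x : V) : repr (quotv_pi x) - x \in W.
Proof. by rewrite -quotv_piE quotv_piK. Qed.

Lemma quotv_piD : {morph quotv_pi : x y / x + y}.
Proof. by move=> x y; rewrite /quotv_pi Quotient.pi_add. Qed.

Definition quotv_scale (a : K) (x : quotv) : quotv := quotv_pi (a *: repr x).

Lemma quotv_scale_pi a x : quotv_scale a (quotv_pi x) = quotv_pi (a *: x).
Proof. by apply: quotv_eq; rewrite -scalerBr rpredZ ?quotv_repr. Qed.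

Fact quotv_scaleA a b x : quotv_scale a (quotv_scale b x) = quotv_scale (a * b) x.
Proof. by rewrite -[x]quotv_piK !quotv_scale_pi scalerA. Qed.

Fact quotv_scale1 : left_id 1 quotv_scale.
Proof. by move=> x; rewrite -[x]quotv_piK quotv_scale_pi scale1r. Qed.

Fact quotv_scaleDr : right_distributive quotv_scale +%R.
Proof.
move=> a x y; rewrite -[x]quotv_piK -[y]quotv_piK -quotv_piD !quotv_scale_pi.
by rewrite scalerDr quotv_piD.
Qed.

Fact quotv_scaleDl x : {morph quotv_scale^~ x : a b / a + b}.
Proof. by move=> a b; rewrite -[x]quotv_piK !quotv_scale_pi scalerDl quotv_piD. Qed.

HB.instance Definition _ := GRing.Zmodule_isLmodule.Build K quotv
  quotv_scaleA quotv_scale1 quotv_scaleDr quotv_scaleDl.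

Lemma quotv_pi_is_linear : linear quotv_pi.
Proof. by move=> a x y; rewrite quotv_piD -quotv_scale_pi. Qed.

HB.instance Definition _ := GRing.isLinear.Build K V quotv _ quotv_pi
  quotv_pi_is_linear.

Fact quotv_vect_iso : Vector.axiom (dim (subvs_of (W^C)%VS)) quotv.
Proof.
have capC : (W^C :&: W = 0)%VS by rewrite capvC capv_compl.
have capC' : (W :&: W^C = 0)%VS by rewrite capv_compl.
pose p := daddv_pi (W^C)%VS W.
have padd x : p x + daddv_pi W (W^C)%VS x = x.
  by apply: daddv_pi_add; rewrite // addvC addv_complf memvf.
have pW w : w \in W -> p w = 0.
  move=> wW; have := padd w; rewrite (daddv_pi_id capC' wW).
  by move/(canRL (addrK w)); rewrite subrr.
pose f (x : quotv) : subvs_of (W^C)%VS := vsproj _ (p (repr x)).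
have fpi x : f (quotv_pi x) = vsproj _ (p x).
  rewrite /f; congr (vsproj _ _); apply/eqP.
  by rewrite -subr_eq0 -raddfB; apply/eqP/pW/quotv_repr.
have f_lin : linear f.
  move=> a x y; rewrite -[x]quotv_piK -[y]quotv_piK -linearP !fpi.
  by rewrite !linearP.
exists (v2r \o f) => [a x y|]; first by rewrite /= f_lin linearP.
apply: bij_comp; first by exists r2v; [apply: v2rK | apply: r2vK].
exists (fun y => quotv_pi (vsval y)) => [x|y].
  rewrite -[RHS]quotv_piK; apply: quotv_eq.
  rewrite /f vsprojK ?memv_pi // -{2}[repr x]padd opprD addNKr.
  by rewrite rpredN memv_pi.
by rewrite fpi [p _]daddv_pi_id ?subvsP // vsvalK.
Qed.

HB.instance Definition _ := Lmodule_hasFinDim.Build K quotv quotv_vect_iso.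

End QuotientSpace.

Section Homology.

Variables (K : fieldType) (A B C : vectType K).
Variables (d2 : 'Hom(A, B)) (d1 : 'Hom(B, C)).

Definition cycles : {vspace B} := lker d1.

Definition boundaries : {vspace subvs_of cycles} :=
  (linfun (vsval : subvs_of cycles -> B) @^-1: limg d2)%VS.

Definition homology : vectType K := quotv boundaries.

(* The class of a cycle; a junk value when [d1 z != 0]. *)
Definition hclass (z : B) : homology := quotv_pi boundaries (vsproj cycles z).

Definition hrepr (x : homology) : B := vsval (repr (x : quotv boundaries)).

Lemma hrepr_cycle x : hrepr x \in cycles.
Proof. exact: subvsP. Qed.

Lemma hreprK x : hclass (hrepr x) = x.
Proof. by rewrite /hclass /hrepr vsvalK quotv_piK. Qed.

Lemma hclass_is_linear : linear hclass.
Proof. by move=> a x y; rewrite /hclass !linearP. Qed.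

HB.instance Definition _ := GRing.isLinear.Build K B homology _ hclass
  hclass_is_linear.

Lemma hrepr_class z : z \in cycles -> hrepr (hclass z) - z \in limg d2.
Proof.
move=> zZ; have := quotv_repr boundaries (vsproj cycles z).
by rewrite /boundaries -memv_preim lfunE /= vsprojK.
Qed.

Lemma hreprP a x y :
  hrepr (a *: x + y) - (a *: hrepr x + hrepr y) \in limg d2.
Proof.
rewrite -{1}[x]hreprK -{1}[y]hreprK -linearP.
by apply: hrepr_class; rewrite rpredD ?rpredZ ?hrepr_cycle.
Qed.

End Homology.

Section Chains.

Definition chain (I : finType) : vectType 'F_2 := {ffun I -> ('F_2)^o}.

Definition dot (I : finType) (x y : chain I) : 'F_2 := \sum_i x i * y i.

Variables (I J : finType) (inc : I -> J -> bool).

Definition bound_fun (x : chain I) : chain J :=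
  [ffun j => \sum_i x i * (inc i j)%:R].

Lemma bound_is_linear : linear bound_fun.
Proof.
move=> a x y; apply/ffunP=> j; rewrite !ffunE scaler_sumr -big_split /=.
by apply: eq_bigr => i _; rewrite !ffunE mulrDl scalerAl.
Qed.

HB.instance Definition _ := GRing.isLinear.Build 'F_2 (chain I) (chain J) _
  bound_fun bound_is_linear.

Definition bound : 'Hom(chain I, chain J) := linfun bound_fun.

Lemma boundE x j : bound x j = \sum_i x i * (inc i j)%:R.
Proof. by rewrite lfunE ffunE. Qed.

End Chains.

Lemma dot_bound (I J : finType) (inc : I -> J -> bool) x y :
  dot (bound inc x) y = dot x (bound (fun j i => inc i j) y).
Proof.
transitivity (\sum_j \sum_i x i * (inc i j)%:R * y j).
  by apply: eq_bigr => j _; rewrite boundE mulr_suml.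
rewrite exchange_big; apply: eq_bigr => i _ /=.
by rewrite boundE mulr_sumr; apply: eq_bigr => j _; rewrite mulrAC mulrA.
Qed.

Lemma dotC (I : finType) (x y : chain I) : dot x y = dot y x.
Proof. by apply: eq_bigr => i _; rewrite mulrC. Qed.

Lemma dotPl (I : finType) a (x y z : chain I) :
  dot (a *: x + y) z = a * dot x z + dot y z.
Proof.
rewrite /dot mulr_sumr -big_split; apply: eq_bigr => i _ /=.
by rewrite !ffunE mulrDl [_ *: _]/(_ * _) mulrA.
Qed.

Lemma dotBl (I : finType) (x y z : chain I) :
  dot (x - y) z = dot x z - dot y z.
Proof. by rewrite addrC -scaleN1r dotPl mulN1r addrC. Qed.

Lemma F2_addrr (x : 'F_2) : x + x = 0.
Proof. by case: x => [[|[|]]] // ?; apply/val_inj. Qed.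


(* A ribbon graph, up to homeomorphisms preserving vertices, edges and the
   numbering of the edges, is determined by the corners of its ribbons and by
   how these are joined along three kinds of segments: [att c] and [fre c] are
   the other ends of the attaching side and of the free side starting at the
   corner [c], and [arc c] is the other end of the arc of a vertex boundary
   which starts at [c] and meets no attaching side except at its two ends.
   Vertex boundaries with at least one attaching side are the circles formed by
   the attaching sides and the arcs; [isolated] is the set of the vertices
   without attaching sides.  An arc may join the two corners of one attaching
   side, so [arc c = att c] is allowed. *)
Record ribbon_graph (n : nat) := RibbonGraph {
  corner : finType;
  isolated : finType;
  edge : corner -> 'I_n;
  att : corner -> corner;
  fre : corner -> corner;
  arc : corner -> corner;
  attK : involutive att;
  freK : involutive fre;
  arcK : involutive arc;
  att_neq : forall c, att c != c;
  fre_neq : forall c, fre c != c;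
  arc_neq : forall c, arc c != c;
  att_fre : forall c, att (fre c) = fre (att c);
  att_neq_fre : forall c, att c != fre c;
  edge_att : forall c, edge (att c) = edge c;
  edge_fre : forall c, edge (fre c) = edge c;
  edge_ex : forall i, exists c, edge c = i;
  edge_eq : forall c d, edge c = edge d ->
    d \in [:: c; att c; fre c; att (fre c)]
}.

Section Pairs.

Variables (T : finType) (f : T -> T).

Definition pairs : finType := {A : {set T} | [exists c, A == [set c; f c]]}.

Fact pair_subproof c : [exists d, [set c; f c] == [set d; f d]].
Proof. by apply/existsP; exists c. Qed.

Definition pair (c : T) : pairs := exist _ [set c; f c] (pair_subproof c).

End Pairs.

Section Complex.

Variables (n : nat) (G : ribbon_graph n).

(* The boundary circles of the vertices, with a base point added on each circle
   which carries no corner. *)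
Definition circ0 : finType := (corner G + isolated G)%type.

Inductive circ1 :=
  | AttSide of pairs (@att n G)
  | Arc of pairs (@arc n G)
  | Loop of isolated G.

Definition circ1_to s : pairs (@att n G) + (pairs (@arc n G) + isolated G) :=
  match s with
  | AttSide A => inl A | Arc A => inr (inl A) | Loop v => inr (inr v)
  end.
Definition circ1_of s :=
  match s with
  | inl A => AttSide A | inr (inl A) => Arc A | inr (inr v) => Loop v
  end.
Lemma circ1_toK : cancel circ1_to circ1_of. Proof. by case. Qed.
HB.instance Definition _ := Finite.copy circ1 (can_type circ1_toK).

Definition circ_inc (s : circ1) (x : circ0) : bool :=
  match s, x with
  | AttSide A, inl c => c \in val A
  | Arc A, inl c => c \in val A
  | _, _ => false
  end.

(* Cells of the punctured ribbon graph.  A vertex with an open disk removed is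
   the product of its boundary circle with an interval; [false] is the level of
   the boundary of the vertex and [true] that of the boundary of the puncture.
   [Radial x] and [Sector s] are the products of [x] and [s] with the
   interval. *)
Definition cell0 : finType := (circ0 * bool)%type.

Inductive cell1 :=
  | Circ of circ1 & bool
  | Radial of circ0
  | FreSide of pairs (@fre n G).

Definition cell1_to e : circ1 * bool + (circ0 + pairs (@fre n G)) :=
  match e with
  | Circ s b => inl (s, b) | Radial x => inr (inl x) | FreSide A => inr (inr A)
  end.
Definition cell1_of e :=
  match e with
  | inl (s, b) => Circ s b | inr (inl x) => Radial x | inr (inr A) => FreSide A
  end.
Lemma cell1_toK : cancel cell1_to cell1_of. Proof. by case. Qed.
HB.instance Definition _ := Finite.copy cell1 (can_type cell1_toK).

Inductive cell2 := Sector of circ1 | Ribbon of 'I_n.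

Definition cell2_to f : circ1 + 'I_n :=
  match f with Sector s => inl s | Ribbon i => inr i end.
Definition cell2_of f :=
  match f with inl s => Sector s | inr i => Ribbon i end.
Lemma cell2_toK : cancel cell2_to cell2_of. Proof. by case. Qed.
HB.instance Definition _ := Finite.copy cell2 (can_type cell2_toK).

Definition on_edge (i : 'I_n) (A : {set corner G}) : bool :=
  [exists c in A, edge c == i].

(* Incidence modulo 2: a [Loop] meets its base point twice, and the sector over
   it meets the corresponding radius twice. *)
Definition inc1 (e : cell1) (v : cell0) : bool :=
  match e, v with
  | Circ s b, (x, b') => (b == b') && circ_inc s x
  | Radial x, (y, _) => x == y
  | FreSide A, (inl c, false) => c \in val A
  | _, _ => false
  end.

Definition inc2 (f : cell2) (e : cell1) : bool :=
  match f, e with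
  | Sector s, Circ s' _ => s == s'
  | Sector s, Radial x => circ_inc s x
  | Ribbon i, Circ (AttSide A) false => on_edge i (val A)
  | Ribbon i, FreSide A => on_edge i (val A)
  | _, _ => false
  end.

Definition bd1 := bound inc1.
Definition bd2 := bound inc2.

(* Relative chains of the pair (surface, boundary) for the dual cell
   decomposition: the dual of a k-cell is a (2-k)-cell, the dual of a 1-cell on
   the boundary of the surface being a segment which ends on this boundary. *)
Definition rbd1 := bound (fun (e : cell1) (f : cell2) => inc2 f e).
Definition rbd2 := bound (fun (v : cell0) (e : cell1) => inc1 e v).

Definition H1 := homology bd2 bd1.
Definition H1rel := homology rbd2 rbd1.

(* A 1-cell and its dual cross exactly once (after pushing the 1-cell off the
   boundary of the surface, if it lies there), and a 1-cell does not meet the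
   duals of the other ones. *)
Definition cap (x : H1) (y : H1rel) : 'F_2 := dot (hrepr x) (hrepr y).

(* alpha_i crosses the two free sides of the ribbon i and ends there; beta_i
   crosses its two attaching sides, then the sectors next to these, and ends on
   the parts of the boundaries of the punctures facing the attaching sides. *)
Definition alpha_chain (i : 'I_n) : chain cell1 :=
  [ffun e => if e is FreSide A then (on_edge i (val A))%:R else 0].

Definition beta_chain (i : 'I_n) : chain cell1 :=
  [ffun e => if e is Circ (AttSide A) _ then (on_edge i (val A))%:R else 0].

Definition alpha (i : 'I_n) : H1rel := hclass rbd2 rbd1 (alpha_chain i).
Definition beta (i : 'I_n) : H1rel := hclass rbd2 rbd1 (beta_chain i).

End Complex.

Section ComplexTheory.

Variables (n : nat) (G : ribbon_graph n).

Lemma mem_pair (T : finType) (f : T -> T) c d :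
  (d \in val (pair f c)) = (d == c) || (d == f c).
Proof. by rewrite !inE. Qed.

Lemma pairP (T : finType) (f : T -> T) (A : pairs f) : exists c, A = pair f c.
Proof. by have /existsP[c /eqP eA] := valP A; exists c; apply/val_inj. Qed.

Lemma pair_eq (T : finType) (f : T -> T) c (A : pairs f) :
  involutive f -> c \in val A -> A = pair f c.
Proof.
move=> fK; have [d ->] := pairP A; rewrite mem_pair => /orP[]/eqP-> //.
by apply/val_inj; rewrite /= fK setUC.
Qed.

Lemma on_edge_att i c : on_edge i (val (pair (@att n G) c)) = (edge c == i).
Proof.
apply/existsP/idP => [[d]|ec]; last by exists c; rewrite mem_pair eqxx.
by rewrite mem_pair => /andP[/orP[]/eqP->]; rewrite ?edge_att.
Qed.

Lemma on_edge_fre i c : on_edge i (val (pair (@fre n G) c)) = (edge c == i).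
Proof.
apply/existsP/idP => [[d]|ec]; last by exists c; rewrite mem_pair eqxx.
by rewrite mem_pair => /andP[/orP[]/eqP->]; rewrite ?edge_fre.
Qed.

Lemma sum_pair_nat (T : finType) (f : T -> T) c (P : pred (pairs f)) :
  involutive f ->
  \sum_(A : pairs f) (P A && (c \in val A))%:R = (P (pair f c))%:R :> 'F_2.
Proof.
move=> fK; rewrite (bigD1 (pair f c)) //= mem_pair eqxx andbT big1 ?addr0 //.
move=> A nA; case cA: (c \in val A); last by rewrite andbF.
by rewrite (pair_eq fK cA) eqxx in nA.
Qed.

Lemma sum_circ1 (R : nmodType) (F : circ1 G -> R) :
  \sum_s F s = \sum_A F (AttSide A) + \sum_A F (Arc A) + \sum_v F (Loop v).
Proof.
rewrite (reindex (@circ1_of n G)) /=; last first.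
  by exists (@circ1_to n G) => [[|[]]|[]].
by rewrite !big_sumType /= addrA.
Qed.

Lemma sum_cell1 (R : nmodType) (F : cell1 G -> R) :
  \sum_e F e = \sum_s (F (Circ s false) + F (Circ s true))
    + \sum_x F (Radial x) + \sum_A F (FreSide A).
Proof.
rewrite (reindex (@cell1_of n G)) /=; last first.
  by exists (@cell1_to n G) => [[[]|[]]|[]].
rewrite !big_sumType /= addrA; congr (_ + _ + _).
transitivity (\sum_s \sum_b F (Circ s b)); last first.
  by apply: eq_bigr => s _; rewrite big_bool addrC.
by rewrite pair_bigA; apply: eq_bigr => -[].
Qed.

Lemma sum_on_edge_att i : \sum_(A : pairs (@att n G)) (on_edge i (val A))%:R = 0 :> 'F_2.
Proof.
have [c ec] := edge_ex G i.
rewrite (bigD1 (pair _ c)) // (bigD1 (pair _ (fre c))) /=; last first.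
  apply/eqP=> /(congr1 (fun A : pairs _ => fre c \in val A)).
  rewrite !mem_pair eqxx (negPf (fre_neq c)) [fre c == att c]eq_sym.
  by rewrite (negPf (att_neq_fre c)).
rewrite !on_edge_att edge_fre ec eqxx addrA F2_addrr add0r.
apply: big1 => A; have [d ->] := pairP A; rewrite on_edge_att.
have [ed|//] := eqVneq (edge d) i.
have := edge_eq (etrans ec (esym ed)); rewrite !inE => dc /andP[A1 A2].
have pa x : pair (@att n G) (att x) = pair (@att n G) x.
  by apply/val_inj; rewrite /= attK setUC.
by case/or4P: dc A1 A2 => /eqP->; rewrite ?pa eqxx.
Qed.

Lemma sum_on_edge_fre i : \sum_(A : pairs (@fre n G)) (on_edge i (val A))%:R = 0 :> 'F_2.
Proof.
have [c ec] := edge_ex G i.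
rewrite (bigD1 (pair _ c)) // (bigD1 (pair _ (att c))) /=; last first.
  apply/eqP=> /(congr1 (fun A : pairs _ => att c \in val A)).
  by rewrite !mem_pair eqxx (negPf (att_neq c)) (negPf (att_neq_fre c)).
rewrite !on_edge_fre edge_att ec eqxx addrA F2_addrr add0r.
apply: big1 => A; have [d ->] := pairP A; rewrite on_edge_fre.
have [ed|//] := eqVneq (edge d) i.
have := edge_eq (etrans ec (esym ed)); rewrite !inE => dc /andP[A1 A2].
have pa x : pair (@fre n G) (fre x) = pair (@fre n G) x.
  by apply/val_inj; rewrite /= freK setUC.
by case/or4P: dc A1 A2 => /eqP->; rewrite ?att_fre ?pa eqxx.
Qed.

Lemma on_edge_att_eq i j (A : pairs (@att n G)) :
  on_edge i (val A) && on_edge j (val A) = (i == j) && on_edge i (val A).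
Proof.
have [c ->] := pairP A; rewrite !on_edge_att andbC.
by have [<-|] := eqVneq (edge c) i; rewrite ?andbF // andbT eq_sym.
Qed.

Lemma on_edge_fre_eq i j (A : pairs (@fre n G)) :
  on_edge i (val A) && on_edge j (val A) = (i == j) && on_edge i (val A).
Proof.
have [c ->] := pairP A; rewrite !on_edge_fre andbC.
by have [<-|] := eqVneq (edge c) i; rewrite ?andbF // andbT eq_sym.
Qed.

Lemma alpha_cycle i : alpha_chain G i \in cycles (rbd1 G).
Proof.
rewrite memv_ker; apply/eqP/ffunP=> f; rewrite boundE ffunE sum_cell1.
rewrite [X in X + _ + _]big1 => [|s _]; last by rewrite !ffunE !mul0r addr0.
rewrite [X in _ + X + _]big1 => [|x _]; last by rewrite ffunE mul0r.
rewrite !add0r.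
case: f => [s|j]; first by apply: big1 => A _; rewrite mulr0.
under eq_bigr do rewrite ffunE -natrM mulnb on_edge_fre_eq.
have [_|_] /= := eqVneq i j; last exact: big1.
exact: sum_on_edge_fre.
Qed.

Lemma beta_cycle i : beta_chain G i \in cycles (rbd1 G).
Proof.
rewrite memv_ker; apply/eqP/ffunP=> f; rewrite boundE ffunE sum_cell1.
rewrite [X in _ + X]big1 => [|A _]; last by rewrite ffunE mul0r.
rewrite [X in _ + X + _]big1 => [|x _]; last by rewrite ffunE mul0r.
rewrite !addr0; case: f => [s|j].
  by apply: big1 => s' _; rewrite !ffunE /= -mulrDl F2_addrr mul0r.
rewrite sum_circ1 [X in _ + X]big1 => [|v _]; last by rewrite !ffunE !mul0r addr0.
rewrite [X in _ + X + _]big1 => [|A _]; last by rewrite !ffunE !mul0r addr0.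
rewrite !addr0.
under eq_bigr do rewrite !ffunE /= mulr0 addr0 -natrM mulnb on_edge_att_eq.
have [_|_] /= := eqVneq i j; last exact: big1.
exact: sum_on_edge_att.
Qed.

Lemma bd1_bd2 x : bd1 G (bd2 G x) = 0.
Proof.
apply/ffunP=> v; rewrite boundE ffunE.
transitivity (\sum_f x f * \sum_e (inc2 f e)%:R * (inc1 e v)%:R : 'F_2).
  under eq_bigr do rewrite boundE mulr_suml; rewrite exchange_big /=.
  by apply: eq_bigr => f _; rewrite mulr_sumr; under eq_bigr do rewrite -mulrA.
apply: big1 => f _; apply/eqP; rewrite mulf_eq0; apply/orP; right; apply/eqP.
under eq_bigr do rewrite -natrM mulnb.
rewrite sum_cell1; case: f => [s|i]; case: v => x' b.
  rewrite [X in _ + X]big1 // (bigD1 s) //= big1 => [|s' /negPf]; last first.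
    by rewrite eq_sym => ->; rewrite addr0.
  rewrite (bigD1 x') //= big1 => [|y /negPf->]; last by rewrite andbF.
  rewrite !eqxx !andbT; case: b => /=; rewrite !addr0 ?add0r; exact: F2_addrr.
rewrite [X in _ + X + _]big1 => [|y _]; last by [].
rewrite sum_circ1 [X in _ + X + _ + _]big1 => [|w _]; last by rewrite addr0.
rewrite [X in _ + X + _ + _ + _]big1 => [|A _]; last by rewrite addr0.
rewrite !addr0; case: x' b => [c|w] [] /=.
- by rewrite !big1 ?addr0 // => A _; rewrite ?andbF ?addr0.
- under eq_bigr do rewrite addr0.
  rewrite !sum_pair_nat ?on_edge_att ?on_edge_fre ?F2_addrr //.
  + exact: freK.
  + exact: attK.
- by rewrite !big1 ?addr0 // => A _; rewrite ?andbF ?addr0.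
- by rewrite !big1 ?addr0 // => A _; rewrite ?andbF ?addr0.
Qed.

Lemma cap_hclass z w : z \in cycles (bd1 G) -> w \in cycles (rbd1 G) ->
  cap (hclass (bd2 G) (bd1 G) z) (hclass (rbd2 G) (rbd1 G) w) = dot z w.
Proof.
move=> zZ wZ; rewrite /cap.
have dot0 u y : y \in cycles (rbd1 G) -> u \in limg (bd2 G) -> dot u y = 0.
  rewrite memv_ker => /eqP y0 /memv_imgP[t _ ->]; rewrite dot_bound.
  by rewrite [bound _ y]y0; apply: big1 => f _; rewrite ffunE mulr0.
have dot0' u y : y \in cycles (bd1 G) -> u \in limg (rbd2 G) -> dot y u = 0.
  rewrite memv_ker => /eqP y0 /memv_imgP[t _ ->]; rewrite dotC dot_bound.
  by rewrite [bound _ y]y0; apply: big1 => f _; rewrite ffunE mulr0.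
transitivity (dot z (hrepr (hclass (rbd2 G) (rbd1 G) w))).
  apply/eqP; rewrite -subr_eq0 -dotBl; apply/eqP.
  by apply: dot0; [apply: hrepr_cycle | apply: hrepr_class].
apply/eqP; rewrite -subr_eq0 ![dot z _]dotC -dotBl dotC; apply/eqP.
by apply: dot0' => //; apply: hrepr_class.
Qed.

Lemma capPl a x y z : cap (a *: x + y) z = a * @cap n G x z + cap y z.
Proof.
rewrite -[x]hreprK -[y]hreprK -[z]hreprK -linearP !cap_hclass ?dotPl //;
by rewrite ?rpredD ?rpredZ ?hrepr_cycle.
Qed.

End ComplexTheory.

Section LSpace.

Variable n : nat.

Definition V : vectType 'F_2 := 'rV['F_2]_(n + n).

Definition e_ (i : 'I_n) : V := delta_mx 0 (lshift n i).
Definition f_ (i : 'I_n) : V := delta_mx 0 (rshift n i).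

(* The linear map sending [e_ k] to [g k] and [f_ k] to [h k]. *)
Definition basis_map_fun (g h : 'I_n -> V) (v : V) : V :=
  \sum_k v 0 (lshift n k) *: g k + \sum_k v 0 (rshift n k) *: h k.

Lemma basis_map_is_linear g h : linear (basis_map_fun g h).
Proof.
move=> a u v; rewrite /basis_map_fun scalerDr addrACA.
by congr (_ + _); rewrite scaler_sumr -big_split; apply: eq_bigr => k _;
   rewrite !mxE scalerDl scalerA.
Qed.

HB.instance Definition _ g h := GRing.isLinear.Build 'F_2 V V _
  (basis_map_fun g h) (basis_map_is_linear g h).

Definition basis_map (g h : 'I_n -> V) : 'End(V) := linfun (basis_map_fun g h).

Lemma basis_map_e g h k : basis_map g h (e_ k) = g k.
Proof.
rewrite lfunE /= /basis_map_fun [X in _ + X]big1 => [|l _]; last first.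
  by rewrite mxE eq_rlshift andbF scale0r.
rewrite addr0 (bigD1 k) //= big1 ?addr0 => [|l lk].
  by rewrite mxE !eqxx scale1r.
by rewrite mxE (inj_eq (@lshift_inj _ _)) (negPf lk) andbF scale0r.
Qed.

Lemma basis_map_f g h k : basis_map g h (f_ k) = h k.
Proof.
rewrite lfunE /= /basis_map_fun [X in X + _]big1 => [|l _]; last first.
  by rewrite mxE eq_lrshift andbF scale0r.
rewrite add0r (bigD1 k) //= big1 ?addr0 => [|l lk].
  by rewrite mxE !eqxx scale1r.
by rewrite mxE (inj_eq (@rshift_inj _ _)) (negPf lk) andbF scale0r.
Qed.

Definition M (i : 'I_n) : 'End(V) :=
  basis_map (fun k => if k == i then f_ i else e_ k)
            (fun k => if k == i then e_ i else f_ k).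

Definition T1 (i j : 'I_n) : 'End(V) :=
  basis_map e_
            (fun k => if k == i then f_ i + e_ j
                      else if k == j then f_ j + e_ i else f_ k).

Definition T2 (i j : 'I_n) : 'End(V) :=
  basis_map (fun k => if k == i then e_ i + e_ j else e_ k)
            (fun k => if k == j then f_ j + f_ i else f_ k).

Variable G : ribbon_graph n.

(* Crossings with [beta i] give the coordinate at [e_ i] and crossings with
   [alpha i] the one at [f_ i].  This choice goes with the maps [T1] and [T2]
   above: for the other one they would have to be conjugated by the interchange
   of all [e_ k] and [f_ k], since the first Vassiliev move changes how often
   the cycles which run along one of the two ribbons cross the beta-arc of the
   other one. *)
Definition phi (x : H1 G) : V :=
  \sum_i cap x (beta G i) *: e_ i + \sum_i cap x (alpha G i) *: f_ i.

Lemma phi_is_linear : linear phi.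
Proof.
move=> a x y; rewrite /phi scalerDr addrACA.
by congr (_ + _); rewrite scaler_sumr -big_split; apply: eq_bigr => k _;
   rewrite capPl scalerDl scalerA.
Qed.

HB.instance Definition _ := GRing.isLinear.Build 'F_2 (H1 G) V _ phi
  phi_is_linear.

Definition L : {vspace V} := limg (linfun phi).

End LSpace.

Section Moves.

Variables (n : nat) (G : ribbon_graph n).

Definition connected : bool :=
  let adj (x y : circ0 G) :=
    match x, y with
    | inl c, inl d => d \in [:: att c; fre c; arc c]
    | _, _ => false
    end in
  (0 < #|circ0 G|)%N && [forall x, forall y, connect adj x y].

Section PartialDual.

Variable i : 'I_n.

Definition mu_att (c : corner G) := if edge c == i then fre c else att c.
Definition mu_fre (c : corner G) := if edge c == i then att c else fre c.

Fact mu_attK : involutive mu_att.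
Proof.
move=> c; rewrite /mu_att; case: (boolP (edge c == i)) => ci.
  by rewrite edge_fre ci freK.
by rewrite edge_att (negPf ci) attK.
Qed.

Fact mu_freK : involutive mu_fre.
Proof.
move=> c; rewrite /mu_fre; case: (boolP (edge c == i)) => ci.
  by rewrite edge_att ci attK.
by rewrite edge_fre (negPf ci) freK.
Qed.

Fact mu_att_neq c : mu_att c != c.
Proof. by rewrite /mu_att; case: ifP; rewrite ?fre_neq ?att_neq. Qed.

Fact mu_fre_neq c : mu_fre c != c.
Proof. by rewrite /mu_fre; case: ifP; rewrite ?fre_neq ?att_neq. Qed.

Fact mu_att_fre c : mu_att (mu_fre c) = mu_fre (mu_att c).
Proof.
by rewrite /mu_att /mu_fre; case: (boolP (edge c == i)) => ci;
   rewrite edge_att edge_fre ?(negPf ci) ?ci att_fre.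
Qed.

Fact mu_att_neq_fre c : mu_att c != mu_fre c.
Proof.
by rewrite /mu_att /mu_fre; case: ifP => _ //; rewrite ?att_neq_fre // eq_sym att_neq_fre.
Qed.

Fact mu_edge_att c : edge (mu_att c) = edge c.
Proof. by rewrite /mu_att; case: ifP; rewrite ?edge_att ?edge_fre. Qed.

Fact mu_edge_fre c : edge (mu_fre c) = edge c.
Proof. by rewrite /mu_fre; case: ifP; rewrite ?edge_att ?edge_fre. Qed.

Fact mu_edge_eq c d : edge c = edge d ->
  d \in [:: c; mu_att c; mu_fre c; mu_att (mu_fre c)].
Proof.
move=> /edge_eq; rewrite /mu_att /mu_fre; case: (boolP (edge c == i)) => ci;
  rewrite !inE ?edge_att ?edge_fre ?(negPf ci) ?ci // -att_fre.
by case/or4P=> ->; rewrite ?orbT.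
Qed.

Definition mu : ribbon_graph n :=
  RibbonGraph (isolated G) mu_attK mu_freK (@arcK n G) mu_att_neq mu_fre_neq
    (@arc_neq n G) mu_att_fre mu_att_neq_fre mu_edge_att mu_edge_fre
    (@edge_ex n G) mu_edge_eq.

End PartialDual.

(* The ribbons are kept and the end of each arc at a corner [c] is moved to the
   corner [s c]. *)
Section Rearc.

Variable s : {perm corner G}.

Definition rearc_arc (c : corner G) := s (arc (s^-1%g c)).

Fact rearc_arcK : involutive rearc_arc.
Proof. by move=> c; rewrite /rearc_arc permK arcK permKV. Qed.

Fact rearc_arc_neq c : rearc_arc c != c.
Proof. by rewrite -{2}[c](permKV s) (inj_eq perm_inj) arc_neq. Qed.

Definition rearc : ribbon_graph n :=
  RibbonGraph (isolated G) (@attK n G) (@freK n G) rearc_arcK (@att_neq n G)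
    (@fre_neq n G) rearc_arc_neq (@att_fre n G) (@att_neq_fre n G)
    (@edge_att n G) (@edge_fre n G) (@edge_ex n G) (@edge_eq n G).

End Rearc.

(* An arc of a vertex boundary without interior attaching points joins the
   corner [p] of the ribbon i to the corner [arc p] of the ribbon j.  Such a
   [p] is the choice on which the Vassiliev moves depend. *)
Definition neighboring (i j : 'I_n) (p : corner G) : bool :=
  [&& i != j, edge p == i & edge (arc p) == j].

(* With [q = arc p], [a = att p] and [b = att q], the vertex boundary reads
     x -- [a p] -- [q b] -- y   before the first move (attaching sides in
   brackets), and  x -- [q b] -- [a p] -- y  after it. *)
Definition v1 (p : corner G) : ribbon_graph n :=
  let q := arc p in rearc (tperm (att p) q * tperm p (att q))%g.

(* With [q = arc p], [b = att q] and [p' = fre p], the boundary of the union of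
   the vertex and the ribbon i reads (attaching side in brackets, free side
   between [p] and [p'])
     y -- [b q] -- p == p' -- z   before the second move, and
     y -- p == p' -- [b q] -- z   after it. *)
Definition v2 (p : corner G) : ribbon_graph n :=
  let q := arc p in rearc (tperm p (att q) * tperm (fre p) q)%g.

Lemma rearc_arcE (s : {perm corner G}) c : @arc n (rearc s) (s c) = s (arc c).
Proof. by rewrite /= /rearc_arc permK. Qed.

Fact tperm2E (T : finType) (a b c d x : T) : uniq [:: a; b; c; d] ->
  (tperm a b * tperm c d)%g x =
    if x == a then b else if x == b then a
    else if x == c then d else if x == d then c else x.
Proof.
rewrite /= !inE !negb_or -!andbA => /and5P[ab ac ad bc /and3P[bd cd _]].
rewrite permM; case: (tpermP a b x) => [->|->|/eqP/negPf-> /eqP/negPf->].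
- by rewrite eqxx tpermD // eq_sym.
- by rewrite eqxx [b == a]eq_sym (negPf ab) tpermD // eq_sym.
- by rewrite permE.
Qed.

Fact edge_neq c d : edge c != @edge n G d -> c != d.
Proof. by apply: contra_neq => ->. Qed.

(* The equality tests only matter for a vertex, respectively a boundary
   component, without other attaching sides than the ones being moved. *)
Lemma v1_arcs i j p : neighboring i j p ->
  [/\ @arc n (v1 p) (att (arc p)) = att p,
      @arc n (v1 p) (arc p)
        = if arc (att p) == att (arc p) then p else arc (att p)
    & @arc n (v1 p) p
        = if arc (att (arc p)) == att p then arc p else arc (att (arc p))].
Proof.
case/and3P=> ij /eqP ei /eqP ej; rewrite /v1; set q := arc p.
have pq : p != q by rewrite edge_neq // ei ej.
have aq : att p != q by rewrite edge_neq // edge_att ei ej.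
have pb : p != att q by rewrite edge_neq // edge_att ei ej.
have ab : att p != att q by rewrite edge_neq // !edge_att ei ej.
set s := (_ * _)%g.
have sE c := @tperm2E (corner G) (att p) q p (att q) c.
have {}sE c : s c = if c == att p then q else if c == q then att p
    else if c == p then att q else if c == att q then p else c.
  apply: sE; rewrite /= !inE !negb_or aq (att_neq p) ab pb /=.
  by rewrite [q == p]eq_sym pq eq_sym att_neq.
have Ep : s p = att q.
  by rewrite sE [p == att p]eq_sym (negPf (att_neq p)) (negPf pq) eqxx.
have Eq : s q = att p by rewrite sE [q == att p]eq_sym (negPf aq) eqxx.
have Ea : s (att p) = q by rewrite sE eqxx.
have Eb : s (att q) = p.
  by rewrite sE [_ == att p]eq_sym (negPf ab) (negPf (att_neq q)) [_ == p]eq_sym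
             (negPf pb) eqxx.
split.
- by rewrite -Ep rearc_arcE.
- rewrite -[in LHS]Ea rearc_arcE sE (negPf (arc_neq _)).
  rewrite (inj_eq (inv_inj (@arcK n G))) (negPf (att_neq p)).
  by rewrite -[arc _ == p](inj_eq (inv_inj (@arcK n G))) arcK (negPf aq).
- rewrite -[in LHS]Eb rearc_arcE sE.
  case: (arc (att q) == att p) => //.
  rewrite (inj_eq (inv_inj (@arcK n G))) [_ == p]eq_sym (negPf pb).
  rewrite -[arc _ == p](inj_eq (inv_inj (@arcK n G))) arcK -/q.
  by rewrite (negPf (att_neq q)) (negPf (arc_neq _)).
Qed.

Lemma v2_arcs i j p : neighboring i j p ->
  [/\ @arc n (v2 p) (fre p) = att (arc p),
      @arc n (v2 p) p
        = if arc (att (arc p)) == fre p then arc p else arc (att (arc p))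
    & @arc n (v2 p) (arc p)
        = if arc (fre p) == att (arc p) then p else arc (fre p)].
Proof.
case/and3P=> ij /eqP ei /eqP ej; rewrite /v2; set q := arc p.
have pq : p != q by rewrite edge_neq // ei ej.
have fq : fre p != q by rewrite edge_neq // edge_fre ei ej.
have pb : p != att q by rewrite edge_neq // edge_att ei ej.
have fb : fre p != att q by rewrite edge_neq // edge_att edge_fre ei ej.
set s := (_ * _)%g.
have sE c := @tperm2E (corner G) p (att q) (fre p) q c.
have {}sE c : s c = if c == p then att q else if c == att q then p
    else if c == fre p then q else if c == q then fre p else c.
  apply: sE; rewrite /= !inE !negb_or fq pq pb [p == _]eq_sym (fre_neq p) /=.
  by rewrite [att q == _]eq_sym fb att_neq.
have Ep : s p = att q by rewrite sE eqxx.
have Eb : s (att q) = p by rewrite sE [_ == p]eq_sym (negPf pb) eqxx.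
have Ef : s (fre p) = q by rewrite sE (negPf (fre_neq p)) (negPf fb) eqxx.
have Eq : s q = fre p.
  by rewrite sE [q == p]eq_sym (negPf pq) [q == att q]eq_sym (negPf (att_neq q))
             [q == _]eq_sym (negPf fq) eqxx.
split.
- by rewrite -[in LHS]Eq rearc_arcE arcK.
- rewrite -[in LHS]Eb rearc_arcE sE.
  rewrite -[arc _ == p](inj_eq (inv_inj (@arcK n G))) arcK -/q.
  rewrite (negPf (att_neq q)) (negPf (arc_neq _)).
  by rewrite (inj_eq (inv_inj (@arcK n G))) [_ == p]eq_sym (negPf pb).
- rewrite -[in LHS]Ef rearc_arcE sE.
  rewrite -[arc _ == p](inj_eq (inv_inj (@arcK n G))) arcK (negPf fq).
  by rewrite (negPf (arc_neq _)) (inj_eq (inv_inj (@arcK n G))) (negPf (fre_neq _)).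
Qed.

End Moves.

(* Main.v *)
(* A cycle in the punctured ribbon graph is recorded, up to homology and as far
   as its intersections with the arcs alpha_i and beta_i go, by a function [u]
   on the attaching sides and a function [w] on the free sides whose sum takes
   equal values at the two ends of each arc of a vertex boundary.  The
   coordinates of its image are the differences of [u], and of [w], between the
   two opposite sides of each ribbon.  The partial dual interchanges [u] and [w]
   on one ribbon; for a Vassiliev move, adding constants to [u] (and [w]) on the
   sides next to the chosen arc gives a solution for the new graph.  All three
   moves are undone by a move of the same kind, as are the linear maps, whence
   equality and not only inclusion of the L-spaces. *)
Require Import Defs.
From mathcomp Require Import all_boot all_order all_algebra perm ring.

Import Defs.

Set Implicit Arguments.
Unset Strict Implicit.
Unset Printing Implicit Defensive.

Import GRing.Theory.
Local Open Scope ring_scope.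

Lemma F2_cases (x : 'F_2) : x = 0 \/ x = 1.
Proof. by case: x => [[|[|]]] // ?; [left | right]; apply/val_inj. Qed.

(** * Functions on the two-element orbits of an involution *)

Section PairSums.

Variables (T : finType) (f : T -> T).
Hypothesis fK : involutive f.

Lemma pair_invol c : pair f (f c) = pair f c.
Proof. by apply/val_inj; rewrite /= fK setUC. Qed.

(** The pairs of an involution partition the set, so [c] lies in exactly one of them and a single
    term survives. *)
Lemma sum_mem_pair (F : pairs f -> 'F_2) c :
  \sum_A F A * (c \in val A)%:R = F (pair f c).
Proof.
rewrite (bigD1 (pair f c)) //= mem_pair eqxx mulr1 big1 ?addr0 // => A nA.
case cA: (c \in val A); last by rewrite mulr0.
by rewrite (pair_eq fK cA) eqxx in nA.
Qed.

Lemma pair_fun (u : T -> 'F_2) : (forall c, u (f c) = u c) ->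
  exists F : pairs f -> 'F_2, forall c, F (pair f c) = u c.
Proof.
move=> uf; have rep (A : pairs f) : exists c, c \in val A.
  by have [c ->] := pairP A; exists c; rewrite mem_pair eqxx.
exists (fun A => u (xchoose (rep A))) => c.
by have := xchooseP (rep (pair f c)); rewrite mem_pair => /orP[]/eqP->.
Qed.

End PairSums.

(** * Boundary equations and the description of the L-space by functions on the sides *)

Section LSpace.

Variables (n : nat) (G : ribbon_graph n).

(** A ribbon has just two attaching sides, those through [c] and [fre c]. *)
Lemma sum_on_edge_att_fun (F : pairs (@att n G) -> 'F_2) c :
  \sum_A F A * (on_edge (edge c) (val A))%:R
  = F (pair _ c) + F (pair _ (fre c)).
Proof.
rewrite (bigD1 (pair _ c)) // (bigD1 (pair _ (fre c))) /=; last first.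
  apply/eqP=> /(congr1 (fun A : pairs _ => fre c \in val A)).
  rewrite !mem_pair eqxx (negPf (fre_neq c)) [fre c == att c]eq_sym.
  by rewrite (negPf (att_neq_fre c)).
rewrite !on_edge_att edge_fre eqxx !mulr1 big1 ?addr0 // => A.
have [d ->] := pairP A; rewrite on_edge_att.
have [ed|] := eqVneq (edge d) (edge c); last by rewrite mulr0.
have := edge_eq (esym ed); rewrite !inE => dc /andP[A1 A2].
by case/or4P: dc A1 A2 => /eqP->; rewrite ?(pair_invol (@attK _ _)) ?eqxx.
Qed.

Lemma sum_on_edge_fre_fun (F : pairs (@fre n G) -> 'F_2) c :
  \sum_A F A * (on_edge (edge c) (val A))%:R
  = F (pair _ c) + F (pair _ (att c)).
Proof.
rewrite (bigD1 (pair _ c)) // (bigD1 (pair _ (att c))) /=; last first.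
  apply/eqP=> /(congr1 (fun A : pairs _ => att c \in val A)).
  by rewrite !mem_pair eqxx (negPf (att_neq c)) (negPf (att_neq_fre c)).
rewrite !on_edge_fre edge_att eqxx !mulr1 big1 ?addr0 // => A.
have [d ->] := pairP A; rewrite on_edge_fre.
have [ed|] := eqVneq (edge d) (edge c); last by rewrite mulr0.
have := edge_eq (esym ed); rewrite !inE => dc /andP[A1 A2].
by case/or4P: dc A1 A2 => /eqP->; rewrite ?att_fre ?(pair_invol (@freK _ _)) ?eqxx.
Qed.

(** The arc beta crosses each attaching side at both levels: on the boundary of the vertex and on
    that of the puncture. *)
Lemma dot_beta (z : chain (cell1 G)) c :
  dot z (beta_chain G (edge c)) =
    z (Circ (AttSide (pair _ c)) false) + z (Circ (AttSide (pair _ c)) true)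
    + (z (Circ (AttSide (pair _ (fre c))) false)
       + z (Circ (AttSide (pair _ (fre c))) true)).
Proof.
rewrite /dot sum_cell1 [X in _ + X]big1 => [|A _]; last by rewrite ffunE mulr0.
rewrite [X in _ + X + _]big1 => [|x _]; last by rewrite ffunE mulr0.
rewrite !addr0 sum_circ1.
rewrite [X in _ + X]big1 => [|v _]; last by rewrite !ffunE !mulr0 addr0.
rewrite [X in _ + X + _]big1 => [|A _]; last by rewrite !ffunE !mulr0 addr0.
rewrite !addr0; under eq_bigr do rewrite !ffunE -mulrDl.
exact: (sum_on_edge_att_fun (fun A =>
  z (Circ (AttSide A) false) + z (Circ (AttSide A) true))).
Qed.

Lemma dot_alpha (z : chain (cell1 G)) c :
  dot z (alpha_chain G (edge c)) =
    z (FreSide (pair _ c)) + z (FreSide (pair _ (att c))).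
Proof.
rewrite /dot sum_cell1 [X in X + _ + _]big1 => [|s _]; last first.
  by rewrite !ffunE !mulr0 addr0.
rewrite [X in _ + X + _]big1 => [|x _]; last by rewrite ffunE mulr0.
rewrite !add0r; under eq_bigr do rewrite ffunE.
exact: (sum_on_edge_fre_fun (fun A => z (FreSide A))).
Qed.

Lemma sum_circ_inc (F : circ1 G -> 'F_2) c :
  \sum_s F s * (circ_inc s (inl c))%:R
  = F (AttSide (pair _ c)) + F (Arc (pair _ c)).
Proof.
rewrite sum_circ1 [X in _ + X]big1 ?addr0 => [|v _]; last by rewrite mulr0.
rewrite (sum_mem_pair (@attK _ _) (fun A => F (AttSide A))).
by rewrite (sum_mem_pair (@arcK _ _) (fun A => F (Arc A))).
Qed.

Lemma sum_radial (F : circ0 G -> 'F_2) x : \sum_y F y * (y == x)%:R = F x.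
Proof.
rewrite (bigD1 x) //= eqxx mulr1 big1 ?addr0 // => y /negPf->.
by rewrite mulr0.
Qed.

Lemma bd1_false (z : chain (cell1 G)) c :
  bd1 G z (inl c, false) =
    z (Circ (AttSide (pair _ c)) false) + z (Circ (Arc (pair _ c)) false)
    + z (Radial (inl c)) + z (FreSide (pair _ c)).
Proof.
rewrite boundE sum_cell1 /=.
rewrite (sum_mem_pair (@freK _ _) (fun A => z (FreSide A))).
rewrite (sum_radial (fun x => z (Radial x))).
under eq_bigr do rewrite mulr0 addr0.
by rewrite (sum_circ_inc (fun s => z (Circ s false))).
Qed.

Lemma bd1_true (z : chain (cell1 G)) c :
  bd1 G z (inl c, true) =
    z (Circ (AttSide (pair _ c)) true) + z (Circ (Arc (pair _ c)) true)
    + z (Radial (inl c)).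
Proof.
rewrite boundE sum_cell1 /=.
rewrite [X in _ + X]big1 ?addr0 => [|A _]; last by rewrite mulr0.
rewrite (sum_radial (fun x => z (Radial x))).
under eq_bigr do rewrite mulr0 add0r.
by rewrite (sum_circ_inc (fun s => z (Circ s true))).
Qed.

(** A loop meets its base point twice, which is zero modulo 2, so only the radius contributes. *)
Lemma bd1_isolated (z : chain (cell1 G)) v b :
  bd1 G z (inr v, b) = z (Radial (inr v)).
Proof.
rewrite boundE sum_cell1 /=.
rewrite [X in _ + X]big1 ?addr0 => [|A _]; last by case: b; rewrite mulr0.
rewrite (sum_radial (fun x => z (Radial x))) big1 ?add0r // => s _.
by case: s => A /=; rewrite !andbF !mulr0 addr0.
Qed.

Lemma phi_hclass z : z \in cycles (bd1 G) -> forall i,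
  phi (hclass (bd2 G) (bd1 G) z) 0 (lshift n i) = dot z (beta_chain G i) /\
  phi (hclass (bd2 G) (bd1 G) z) 0 (rshift n i) = dot z (alpha_chain G i).
Proof.
move=> zZ i; rewrite /phi !mxE !summxE; split.
  rewrite [X in _ + X]big1 ?addr0 => [|k _]; last first.
    by rewrite !mxE eq_lrshift andbF mulr0.
  rewrite (bigD1 i) //= !mxE !eqxx mulr1 big1 ?addr0 => [|k /negPf ki].
    by rewrite cap_hclass ?beta_cycle.
  by rewrite !mxE (inj_eq (@lshift_inj _ _)) eq_sym ki andbF mulr0.
rewrite [X in X + _]big1 ?add0r => [|k _]; last first.
  by rewrite !mxE eq_rlshift andbF mulr0.
rewrite (bigD1 i) //= !mxE !eqxx mulr1 big1 ?addr0 => [|k /negPf ki].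
  by rewrite cap_hclass ?alpha_cycle.
by rewrite !mxE (inj_eq (@rshift_inj _ _)) eq_sym ki andbF mulr0.
Qed.

(** The first two clauses make [u] and [w] functions on sides, encoded as functions on corners. The
    third is the cycle condition, and the last two read off the crossings with beta and alpha. *)
Definition L_witness (x : V n) (u w : corner G -> 'F_2) : Prop :=
  [/\ forall c, u (att c) = u c, forall c, w (fre c) = w c,
      forall c, u (arc c) + w (arc c) = u c + w c,
      forall c, x 0 (lshift n (edge c)) = u c + u (fre c)
    & forall c, x 0 (rshift n (edge c)) = w c + w (att c)].

(* [u] and [w] are the coefficients of a cycle at the attaching sides (summed
   over the two levels, which cancels the radii) and at the free sides; the
   coefficients at the arcs are then forced to be [u + w]. *)
Lemma mem_L x : x \in L G <-> exists u w, L_witness x u w.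
Proof.
split=> [/memv_imgP[y _ ->{x}]|[u [w [uA wF uwA xu xw]]]].
  rewrite lfunE /= -[y]hreprK; have := hrepr_cycle y.
  move: (hrepr y) => z zZ.
  have pe (c : corner G) := phi_hclass zZ (edge c).
  exists (fun c => z (Circ (AttSide (pair _ c)) false)
                   + z (Circ (AttSide (pair _ c)) true)).
  exists (fun c => z (FreSide (pair _ c))).
  split=> c; rewrite ?(pe c).1 ?(pe c).2 ?dot_beta ?dot_alpha //.
  - by rewrite (pair_invol (@attK _ _)).
  - by rewrite (pair_invol (@freK _ _)).
  - move: zZ; rewrite memv_ker => /eqP z0.
    (* Adding the boundary equations at the two levels over [d] cancels the coefficient of the
       radius. *)
    have E d : z (Circ (AttSide (pair _ d)) false)
        + z (Circ (AttSide (pair _ d)) true) + z (FreSide (pair _ d))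
        = z (Circ (Arc (pair _ d)) false) + z (Circ (Arc (pair _ d)) true).
      have := congr1 (fun g : chain _ => g (inl d, false)) z0.
      have := congr1 (fun g : chain _ => g (inl d, true)) z0.
      rewrite bd1_false bd1_true !ffunE.
      move: (z _) (z _) (z _) (z _) (z _) (z _) => a1 a2 a3 a4 a5 a6.
      by case: (F2_cases a1) => ->; case: (F2_cases a2) => ->;
         case: (F2_cases a3) => ->; case: (F2_cases a4) => ->;
         case: (F2_cases a5) => ->; case: (F2_cases a6) => ->;
         move=> /eqP h1 /eqP h2; apply/eqP; move: h1 h2.
    by rewrite !E (pair_invol (@arcK _ _)).
have [U UE] := pair_fun uA; have [W WE] := pair_fun wF.
have [T TE] := pair_fun uwA.
(* The cycle is pushed to the level of the vertex boundaries: radii and the puncture level get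
   coefficient 0, and an arc gets the common value of [u + w] at its two ends. *)
pose z : chain (cell1 G) := [ffun e => match e with
  | Circ (AttSide A) false => U A | Circ (Arc A) false => T A
  | FreSide A => W A | _ => 0 end].
have zZ : z \in cycles (bd1 G).
  rewrite memv_ker; apply/eqP/ffunP=> -[[c|v] b]; last first.
    by rewrite bd1_isolated !ffunE.
  case: b; first by rewrite bd1_true !ffunE !addr0.
  rewrite bd1_false !ffunE UE TE WE addr0.
  by rewrite addrA F2_addrr add0r F2_addrr.
apply/memv_imgP; exists (hclass (bd2 G) (bd1 G) z); first exact: memvf.
rewrite lfunE /=; apply/rowP=> k.
rewrite -[k]splitK; case: (split k) => i /=; have [c <-] := edge_ex G i.
  by rewrite (phi_hclass zZ _).1 dot_beta !ffunE !addr0 !UE xu.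
by rewrite (phi_hclass zZ _).2 dot_alpha !ffunE !WE xw.
Qed.

End LSpace.

(** * Coordinates of the three linear maps, and their involutivity *)

Section BasisMaps.

Variable n : nat.
Implicit Types (x : V n) (i j k : 'I_n).

Lemma basis_mapE (g h : 'I_n -> V n) x m :
  basis_map g h x 0 m = \sum_k x 0 (lshift n k) * g k 0 m
                        + \sum_k x 0 (rshift n k) * h k 0 m.
Proof.
by rewrite lfunE /= /basis_map_fun mxE !summxE; congr (_ + _);
   apply: eq_bigr => k _; rewrite mxE.
Qed.

Lemma V_addE (x y : V n) m : (x + y) 0 m = x 0 m + y 0 m.
Proof. by rewrite mxE. Qed.

Lemma e_l i k : e_ i 0 (lshift n k) = (k == i)%:R.
Proof. by rewrite mxE (inj_eq (@lshift_inj _ _)). Qed.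
Lemma e_r i k : e_ i 0 (rshift n k) = 0.
Proof. by rewrite mxE eq_rlshift andbF. Qed.
Lemma f_l i k : f_ i 0 (lshift n k) = 0.
Proof. by rewrite mxE eq_lrshift andbF. Qed.
Lemma f_r i k : f_ i 0 (rshift n k) = (k == i)%:R.
Proof. by rewrite mxE (inj_eq (@rshift_inj _ _)). Qed.

Lemma sum_delta (h : 'I_n -> 'I_(n + n)) x k :
  \sum_l x 0 (h l) * (k == l)%:R = x 0 (h k).
Proof.
rewrite (bigD1 k) //= eqxx mulr1 big1 ?addr0 // => l.
by rewrite eq_sym => /negPf->; rewrite mulr0.
Qed.

Lemma M_l i x k :
  M i x 0 (lshift n k) = if k == i then x 0 (rshift n i) else x 0 (lshift n k).
Proof.
rewrite basis_mapE; have [->{k}|ki] := eqVneq k i.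
  rewrite big1 ?add0r => [|l _]; last first.
    by case: eqVneq => [_|li]; rewrite ?f_l ?e_l ?mulr0 // eq_sym (negPf li) mulr0.
  rewrite (bigD1 i) //= eqxx e_l eqxx mulr1 big1 ?addr0 // => l /negPf->.
  by rewrite f_l mulr0.
rewrite addrC big1 ?add0r => [|l _]; last first.
  by case: eqVneq => [_|li]; rewrite ?f_l ?e_l ?mulr0 // (negPf ki) mulr0.
rewrite -[RHS]sum_delta; apply: eq_bigr => l _; congr (_ * _).
by case: eqVneq => [->|_]; rewrite ?f_l ?e_l ?(negPf ki).
Qed.

Lemma M_r i x k :
  M i x 0 (rshift n k) = if k == i then x 0 (lshift n i) else x 0 (rshift n k).
Proof.
rewrite basis_mapE; have [->{k}|ki] := eqVneq k i.
  rewrite addrC big1 ?add0r => [|l _]; last first.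
    by case: eqVneq => [_|li]; rewrite ?f_r ?e_r ?mulr0 // eq_sym (negPf li) mulr0.
  rewrite (bigD1 i) //= eqxx f_r eqxx mulr1 big1 ?addr0 // => l /negPf->.
  by rewrite e_r mulr0.
rewrite big1 ?add0r => [|l _]; last first.
  by case: eqVneq => [_|li]; rewrite ?f_r ?e_r ?mulr0 // (negPf ki) mulr0.
rewrite -[RHS]sum_delta; apply: eq_bigr => l _; congr (_ * _).
by case: eqVneq => [->|_]; rewrite ?f_r ?e_r ?(negPf ki).
Qed.

(** On coordinates the map acts by the transposed matrix: the term [e_ j] in the image of [f_ i]
    adds the coordinate at [f_ i] to the one at [e_ j]. *)
Lemma T1_l i j x k : i != j -> T1 i j x 0 (lshift n k) =
  x 0 (lshift n k) + (k == j)%:R * x 0 (rshift n i)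
  + (k == i)%:R * x 0 (rshift n j).
Proof.
move=> ij; rewrite basis_mapE -addrA; congr (_ + _).
  by under eq_bigr do rewrite e_l; exact: sum_delta.
rewrite (bigD1 i) // (bigD1 j) 1?eq_sym //= big1 ?addr0 => [|l /andP[li lj]].
  by rewrite !eqxx [j == i]eq_sym (negPf ij) !V_addE !f_l !e_l !add0r ![_ * _%:R]mulrC.
by rewrite (negPf li) (negPf lj) f_l mulr0.
Qed.

Lemma T1_r i j x k : T1 i j x 0 (rshift n k) = x 0 (rshift n k).
Proof.
rewrite basis_mapE big1 ?add0r => [|l _]; last by rewrite e_r mulr0.
rewrite -[RHS]sum_delta; apply: eq_bigr => l _; congr (_ * _).
have [->|li] := eqVneq l i; first by rewrite V_addE f_r e_r addr0.
by have [->|lj] := eqVneq l j; rewrite ?V_addE ?f_r ?e_r ?addr0.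
Qed.

Lemma T2_l i j x k : T2 i j x 0 (lshift n k) =
  x 0 (lshift n k) + (k == j)%:R * x 0 (lshift n i).
Proof.
rewrite basis_mapE addrC big1 ?add0r => [|l _]; last first.
  by case: ifP => _; rewrite ?V_addE ?f_l ?addr0 ?mulr0.
(* The image of each [e_ l] is split into [e_ l] itself and the extra [e_ j], which occurs only for
   [l = i]. *)
transitivity (\sum_l (x 0 (lshift n l) * (k == l)%:R
                     + x 0 (lshift n l) * (i == l)%:R * (k == j)%:R)).
  apply: eq_bigr => l _; rewrite -mulrA -mulrDr; congr (_ * _).
  have [->|li] := eqVneq l i; first by rewrite V_addE !e_l mul1r.
  by rewrite e_l mul0r addr0.
by rewrite big_split /= -mulr_suml !sum_delta mulrC.
Qed.

Lemma T2_r i j x k : T2 i j x 0 (rshift n k) =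
  x 0 (rshift n k) + (k == i)%:R * x 0 (rshift n j).
Proof.
rewrite basis_mapE big1 ?add0r => [|l _]; last first.
  by case: ifP => _; rewrite ?V_addE ?e_r ?addr0 ?mulr0.
transitivity (\sum_l (x 0 (rshift n l) * (k == l)%:R
                     + x 0 (rshift n l) * (j == l)%:R * (k == i)%:R)).
  apply: eq_bigr => l _; rewrite -mulrA -mulrDr; congr (_ * _).
  have [->|li] := eqVneq l j; first by rewrite V_addE !f_r mul1r.
  by rewrite f_r mul0r addr0.
by rewrite big_split /= -mulr_suml !sum_delta mulrC.
Qed.

Lemma M_invol i : involutive (M i).
Proof.
move=> x; apply/rowP=> m; rewrite -[m]splitK; case: (split m) => k /=.
  by rewrite M_l M_r eqxx M_l; case: eqVneq => [->|].
by rewrite M_r M_l eqxx M_r; case: eqVneq => [->|].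
Qed.

(** The added terms are coordinates at [f_ i] and [f_ j], which the map fixes; added twice, they
    cancel. *)
Lemma T1_invol i j : i != j -> involutive (T1 i j).
Proof.
move=> ij x; apply/rowP=> m; rewrite -[m]splitK; case: (split m) => k /=.
  rewrite !T1_l // !T1_r -!addrA; set a := _ * _; set b := _ * _.
  by rewrite (addrA a b) F2_addrr addr0.
by rewrite !T1_r.
Qed.

Lemma T2_invol i j : i != j -> involutive (T2 i j).
Proof.
move=> ij x; apply/rowP=> m; rewrite -[m]splitK; case: (split m) => k /=.
  by rewrite !T2_l (negPf ij) mul0r addr0 -addrA F2_addrr addr0.
by rewrite !T2_r [j == i]eq_sym (negPf ij) mul0r addr0 -addrA F2_addrr addr0.
Qed.

(** For the harder inclusion, [x] is the image of [T x]. Each equality of L-spaces is thereby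
    reduced to two membership statements. *)
Lemma limg_invol (T : 'End(V n)) (U U' : {vspace V n}) : involutive T ->
  (forall x, x \in U -> T x \in U') -> (forall x, x \in U' -> T x \in U) ->
  U' = (T @: U)%VS.
Proof.
move=> TK UU' U'U; apply/vspaceP=> x; apply/idP/memv_imgP => [xU'|[y yU ->]].
  by exists (T x); rewrite ?TK ?U'U.
exact: UU'.
Qed.

End BasisMaps.

(** * Effect of the moves on the functions on the sides *)

Section Moves.

Variables (n : nat) (G : ribbon_graph n).

(** Rearranging by [s] and then by [s'] conjugates [arc] by the product [s * s']. *)
Lemma arc_rearcK (s : {perm corner G}) (s' : {perm corner (rearc s)})
    (c : corner G) :
  (s * s')%g = 1%g -> @arc n (rearc s') c = @arc n G c.
Proof.
move=> ss'; rewrite -[in LHS](perm1 c) -ss' permM rearc_arcE.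
by rewrite [X in s' X]rearc_arcE -permM ss' perm1.
Qed.

Lemma L_rearcK (s : {perm corner G}) (s' : {perm corner (rearc s)}) :
  (s * s')%g = 1%g -> L (rearc s') = L G.
Proof.
move=> ss'; apply/vspaceP=> x; apply/idP/idP=> /mem_L[u [w [uA wF ua xu xw]]];
  apply/mem_L; exists u, w; split=> // c.
  by rewrite -(arc_rearcK c ss') ua.
by rewrite (arc_rearcK c ss').
Qed.

(** The corner [p] lies on exactly one of the two attaching sides if the ribbons agree, and on none
    otherwise. This turns corrections on a single side into the coefficients [(k == j)%:R] of the
    linear maps. *)
Lemma edge_att_count (p c : corner G) :
  ((p == c) || (p == att c))%:R + ((p == fre c) || (p == att (fre c)))%:R
  = (edge c == edge p)%:R :> 'F_2.
Proof.
rewrite -!mem_pair -(sum_on_edge_att_fun (fun A => (p \in val A)%:R)).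
under eq_bigr do rewrite mulrC.
by rewrite (sum_mem_pair (@attK _ _) (fun A => _)) on_edge_att eq_sym.
Qed.

Lemma edge_fre_count (p c : corner G) :
  ((p == c) || (p == fre c))%:R + ((p == att c) || (p == fre (att c)))%:R
  = (edge c == edge p)%:R :> 'F_2.
Proof.
rewrite -!mem_pair -(sum_on_edge_fre_fun (fun A => (p \in val A)%:R)).
under eq_bigr do rewrite mulrC.
by rewrite (sum_mem_pair (@freK _ _) (fun A => _)) on_edge_fre eq_sym.
Qed.

(** The new arcs are the images of the old ones under [s]. Away from the chosen arc the values are
    carried along; on the chosen arc only equality at its two new ends is required, since its value
    may change. *)
Lemma rearc_invariant (s : {perm corner G}) (t t' : corner G -> 'F_2) p :
  (forall c, t (arc c) = t c) ->
  (forall c, c != p -> c != arc p -> t' (s c) = t c) ->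
  t' (s p) = t' (s (arc p)) ->
  forall c, t' (@arc n (rearc s) c) = t' c.
Proof.
move=> ta t's t'p c; rewrite -[c](permKV s) rearc_arcE.
move: (s^-1%g c) => {}c; have [->//|cp] := eqVneq c p.
have [->|cq] := eqVneq c (arc p); first by rewrite arcK.
by rewrite !t's ?ta // -1?[arc c == p](inj_eq (inv_inj (@arcK n G))) ?arcK
           ?(inj_eq (inv_inj (@arcK n G))).
Qed.

Lemma mem_v1 i j (p : corner G) x :
  neighboring i j p -> x \in L G -> T1 i j x \in L (v1 p).
Proof.
case/and3P=> ij /eqP ei /eqP ej /mem_L[u [w [uA wF ua xu xw]]].
set q := arc p in ej.
have pq : p != q by rewrite edge_neq // ei ej.
have aq : att p != q by rewrite edge_neq // edge_att ei ej.
have pb : p != att q by rewrite edge_neq // edge_att ei ej.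
have ab : att p != att q by rewrite edge_neq // !edge_att ei ej.
have xi : x 0 (rshift n i) = w p + w (att p) by rewrite -ei xw.
have xj : x 0 (rshift n j) = w q + w (att q) by rewrite -ej xw.
(* The attaching side of [j] at [q] is corrected by the coordinate at [f_ i] and that of [i] at [p]
   by the coordinate at [f_ j]; [w] is kept. *)
pose u' c := u c + ((q == c) || (q == att c))%:R * x 0 (rshift n i)
                 + ((p == c) || (p == att c))%:R * x 0 (rshift n j).
apply/mem_L; exists u', w; split=> // [c|c|c|c].
- by rewrite /u' /= attK uA ![_ || (_ == c)]orbC.
- have sE d : (tperm (att p) q * tperm p (att q))%g d =
      if d == att p then q else if d == q then att p
      else if d == p then att q else if d == att q then p else d.
    apply: tperm2E; rewrite /= !inE !negb_or aq (att_neq p) ab pb /=.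
    by rewrite [q == p]eq_sym pq eq_sym att_neq.
  have up : u' p = u p + x 0 (rshift n j).
    by rewrite /u' eqxx [q == p]eq_sym (negPf pq) [q == _]eq_sym (negPf aq)
               mul0r addr0 mul1r.
  have uq : u' q = u q + x 0 (rshift n i).
    by rewrite /u' eqxx (negPf pq) (negPf pb) mul0r addr0 mul1r.
  have ua' : u' (att p) = u' p by rewrite /u' attK uA ![_ || (_ == p)]orbC.
  have ub' : u' (att q) = u' q by rewrite /u' attK uA ![_ || (_ == q)]orbC.
  have upq : u q + w q = u p + w p by exact: ua.
  apply: (@rearc_invariant _ (fun c => u c + w c) (fun c => u' c + w c) p) c => //.
    move=> c cp cq; rewrite sE (negPf cp) (negPf cq).
    (* The arc that ended at [att p] now ends at [q], and the one at [att q] now ends at [p]. The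
       two corrections are exactly what preserves [u + w] there. *)
    have [->|ca] := eqVneq c (att p).
      by rewrite uq xi uA addrAC upq addrA -(addrA (u p)) F2_addrr addr0.
    have [->|cb] := eqVneq c (att q).
      by rewrite up xj uA addrAC -upq addrA -(addrA (u q)) F2_addrr addr0.
    rewrite /u' ![_ == c]eq_sym (negPf cp) (negPf cq).
    rewrite -[q == _](inj_eq (inv_inj (@attK n G))) attK.
    rewrite -[p == _](inj_eq (inv_inj (@attK n G))) attK.
    by rewrite ![_ == c]eq_sym (negPf ca) (negPf cb) !mul0r !addr0.
  (* The chosen arc now joins [att q] to [att p]. *)
  rewrite !sE eqxx [p == att p]eq_sym (negPf (att_neq p)) (negPf pq).
  rewrite [q == att p]eq_sym (negPf aq) eqxx ub' ua' up uq xi xj.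
  have -> : u q = u p + w p + w q by rewrite -upq -addrA F2_addrr addr0.
  (* The doubled term [w p + w p] is isolated because [ring] does not use characteristic 2. *)
  transitivity (u p + (w q + w (att q)) + w (att p) + (w p + w p)); first by ring.
  by rewrite F2_addrr addr0.
- rewrite T1_l // [edge c]/= xu /u' -ej -ei -!edge_att_count !mulrDl.
  by rewrite [RHS]addrACA; congr (_ + _); apply: addrACA.
- by rewrite T1_r xw.
Qed.

Lemma mem_v2 i j (p : corner G) x :
  neighboring i j p -> x \in L G -> T2 i j x \in L (v2 p).
Proof.
case/and3P=> ij /eqP ei /eqP ej /mem_L[u [w [uA wF ua xu xw]]].
set q := arc p in ej.
have pq : p != q by rewrite edge_neq // ei ej.
have fq : fre p != q by rewrite edge_neq // edge_fre ei ej.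
have pb : p != att q by rewrite edge_neq // edge_att ei ej.
have fb : fre p != att q by rewrite edge_neq // edge_att edge_fre ei ej.
have xi : x 0 (lshift n i) = u p + u (fre p) by rewrite -ei xu.
have xj : x 0 (rshift n j) = w q + w (att q) by rewrite -ej xw.
(* The moving attaching side of [j] is corrected by the difference of [u] between the two ends of
   [i], and the free side of [i] along which it slides by the difference of [w] between the two free
   sides of [j]. *)
pose u' c := u c + ((q == c) || (q == att c))%:R * x 0 (lshift n i).
pose w' c := w c + ((p == c) || (p == fre c))%:R * x 0 (rshift n j).
apply/mem_L; exists u', w'; split=> // [c|c|c|c|c].
- by rewrite /u' /= attK uA ![_ || (_ == c)]orbC.
- by rewrite /w' /= freK wF ![_ || (_ == c)]orbC.
- have sE d : (tperm p (att q) * tperm (fre p) q)%g d =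
      if d == p then att q else if d == att q then p
      else if d == fre p then q else if d == q then fre p else d.
    apply: tperm2E; rewrite /= !inE !negb_or fq pq pb [p == _]eq_sym (fre_neq p) /=.
    by rewrite [att q == _]eq_sym fb att_neq.
  have u'_id d : d != q -> d != att q -> u' d = u d.
    move=> dq db; rewrite /u' -[q == att d](inj_eq (inv_inj (@attK n G))) attK.
    by rewrite ![_ == d]eq_sym (negPf dq) (negPf db) mul0r addr0.
  have w'_id d : d != p -> d != fre p -> w' d = w d.
    move=> dp df; rewrite /w' -[p == fre d](inj_eq (inv_inj (@freK n G))) freK.
    by rewrite ![_ == d]eq_sym (negPf dp) (negPf df) mul0r addr0.
  have u'q : u' q = u q + x 0 (lshift n i) by rewrite /u' eqxx mul1r.
  have u'b : u' (att q) = u' q by rewrite /u' attK uA ![_ || (_ == q)]orbC.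
  have w'p : w' p = w p + x 0 (rshift n j) by rewrite /w' eqxx mul1r.
  have w'f : w' (fre p) = w' p by rewrite /w' freK wF ![_ || (_ == p)]orbC.
  have upq : u q + w q = u p + w p by exact: ua.
  have u'p : u' p = u p by rewrite u'_id.
  have u'f : u' (fre p) = u (fre p) by rewrite u'_id.
  have w'q : w' q = w q by rewrite w'_id // eq_sym.
  have w'b : w' (att q) = w (att q) by rewrite w'_id // eq_sym.
  apply: (@rearc_invariant _ (fun c => u c + w c) (fun c => u' c + w' c) p) c => //.
    move=> c cp cq; rewrite sE (negPf cp) (negPf cq).
    have [->|cb] := eqVneq c (att q).
      by rewrite u'p w'p xj uA addrA -upq addrA -(addrA (u q)) F2_addrr addr0.
    have [->|cf] := eqVneq c (fre p).
      rewrite w'q u'q xi wF addrAC upq.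
      by rewrite addrAC addrA F2_addrr add0r.
    by rewrite u'_id ?w'_id.
  (* After the slide the chosen arc joins [att q] to [fre p]. *)
  rewrite !sE eqxx [q == p]eq_sym (negPf pq) [q == att q]eq_sym.
  rewrite (negPf (att_neq q)) [q == fre p]eq_sym (negPf fq) eqxx.
  rewrite u'b w'b u'q u'f w'f w'p xi xj.
  have -> : u q = u p + w p + w q by rewrite -upq -addrA F2_addrr addr0.
  transitivity (u (fre p) + (w p + (w q + w (att q))) + (u p + u p)); first by ring.
  by rewrite F2_addrr addr0.
- rewrite T2_l [edge c]/= xu /u' -ej -edge_att_count mulrDl.
  exact: addrACA.
- rewrite T2_r [edge c]/= xw /w' -ei -edge_fre_count mulrDl.
  exact: addrACA.
Qed.

(** Interchanging [u] and [w] on the ribbon [i] leaves [u + w] unchanged, so the condition at the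
    arcs survives. *)
Lemma mem_mu i x : x \in L G -> M i x \in L (mu G i).
Proof.
case/mem_L=> u [w [uA wF ua xu xw]].
apply/mem_L; exists (fun c => if edge c == i then w c else u c).
exists (fun c => if edge c == i then u c else w c); split=> c /=.
- by rewrite mu_edge_att /mu_att; case: ifP => ci; rewrite ci ?uA ?wF.
- by rewrite [edge _]mu_edge_fre /mu_fre; case: ifP => ci; rewrite ci ?uA ?wF.
- have E d : (if edge d == i then w d else u d)
      + (if edge d == i then u d else w d) = u d + w d.
    by case: ifP; rewrite // addrC.
  by rewrite !E ua.
- rewrite M_l /mu_fre; case: eqVneq => [ci|/negPf ci]; last first.
    by rewrite edge_fre ci xu.
  by rewrite edge_att ci eqxx -ci xw.
- rewrite M_r /mu_att; case: eqVneq => [ci|/negPf ci]; last first.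
    by rewrite edge_att ci xw.
  by rewrite edge_fre ci eqxx -ci xu.
Qed.

End Moves.

(** * Each move is undone by a move of the same kind *)

Section Involutions.

Variables (n : nat) (G : ribbon_graph n).

(** The double dual has pointwise the same [att] and [fre] as [G]; the comparison goes through the
    functions [u] and [w] rather than through equality of records. *)
Lemma L_muK i : L (mu (mu G i) i) = L G.
Proof.
have attE (c : corner G) : @att n (mu (mu G i) i) c = @att n G c.
  by rewrite /= /mu_att /= /mu_fre /mu_att; case: ifP => ci; rewrite ci.
have freE (c : corner G) : @fre n (mu (mu G i) i) c = @fre n G c.
  by rewrite /= /mu_fre /= /mu_att /mu_fre; case: ifP => ci; rewrite ci.
apply/vspaceP=> x; apply/idP/idP=> /mem_L[u [w [uA wF ua xu xw]]];
  apply/mem_L; exists u, w; split=> // c.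
- by rewrite -attE uA.
- by rewrite -freE wF.
- by rewrite -freE -xu.
- by rewrite -attE -xw.
- by rewrite attE uA.
- by rewrite freE wF.
- by rewrite freE -xu.
- by rewrite attE -xw.
Qed.

(** After the move [att p] and [att q] are neighbors. The move at [att p] uses the same two
    transpositions in the opposite order, so the product is the identity. *)
Lemma L_v1K i j (p : corner G) : neighboring i j p ->
  L (@v1 n (v1 p) (att p)) = L G /\ @neighboring n (v1 p) i j (att p).
Proof.
move=> nb; have [arcb _ _] := v1_arcs nb; case/and3P: nb => ij ei ej.
have arca : @arc n (v1 p) (att p) = att (arc p) by rewrite -arcb arcK.
split; last by rewrite /neighboring ij [edge _]edge_att ei arca [edge _]edge_att.
rewrite {1}/v1 arca [att (att p)]attK [att (att (arc p))]attK.
by apply: L_rearcK; rewrite -mulgA (mulgA (tperm p _)) tperm2 mul1g tperm2.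
Qed.

(** The end of [j] slides back along the same free side, starting from its other corner [fre p]. *)
Lemma L_v2K i j (p : corner G) : neighboring i j p ->
  L (@v2 n (v2 p) (fre p)) = L G /\ @neighboring n (v2 p) i j (fre p).
Proof.
move=> nb; have [arcf _ _] := v2_arcs nb; case/and3P: nb => ij ei ej.
split; last by rewrite /neighboring ij [edge _]edge_fre ei arcf [edge _]edge_att.
rewrite {1}/v2 arcf [fre (fre p)]freK [att (att (arc p))]attK.
by apply: L_rearcK; rewrite -mulgA (mulgA (tperm (fre p) _)) tperm2 mul1g tperm2.
Qed.

End Involutions.

Theorem theorem3p8 (n : nat) (G : ribbon_graph n) (hG : connected G) :
  (forall i : 'I_n, L (mu G i) = (M i @: L G)%VS) /\
  (forall (i j : 'I_n) (p : corner G), neighboring i j p ->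
     L (v1 p) = (T1 i j @: L G)%VS) /\
  (forall (i j : 'I_n) (p : corner G), neighboring i j p ->
     L (v2 p) = (T2 i j @: L G)%VS).
Proof.
split=> [i|].
  apply: limg_invol => [|x|x xL]; [exact: M_invol | exact: mem_mu |].
  (* The reverse inclusion is the forward one applied to the moved graph, whose own move restores
     the original L-space; the same argument serves the two Vassiliev moves. *)
  by rewrite -(L_muK G i) mem_mu.
split=> i j p nb; have /andP[ij _] := nb.
  apply: limg_invol => [|x|x xL]; [exact: T1_invol | exact: mem_v1 |].
  by have [<- nb'] := L_v1K nb; apply: mem_v1.
apply: limg_invol => [|x|x xL]; [exact: T2_invol | exact: mem_v2 |].
by have [<- nb'] := L_v2K nb; apply: mem_v2.
Qed.
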